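(* Let $f:\mathbb{R}^n\to\mathbb{R}$ be a twice continuously differentiable convex function, and let $x_0\in\mathbb{R}^n$. Let $p^*$ denote the minimum-norm point of the closure $\overline{\nabla f(\mathbb{R}^n)}$ of the gradient image. Suppose that $\kappa^* := \inf_{x \in \mathbb{R}^n} \|\nabla f(x)\| >0$. (1) Let $x(t)$, $t\ge0$, be the solution of $\dot x(t)=-\nabla f(x(t))$, $x(0)=x_0$. Then, as $t\to\infty$, $\nabla f(x(t))$ converges to $p^*$, and $x(t)/t$ converges to $-p^*$. (2) Suppose that $f$ is $L$-smooth for some $L>0$, and let $x_{i+1}:=x_i-\frac1L\nabla f(x_i)$ $(i=0,1,\ldots)$. Then, as $i\to\infty$, $\nabla f(x_i)$ converges to $p^*$, and $x_i/i$ converges to $-p^*/L$.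
   Context: $\mathbb{R}^n$ carries the standard inner product and Euclidean norm. $f$ is $L$-smooth if $\langle \nabla^2f(x)u,u\rangle\le L\|u\|^2$ for all $x,u\in\mathbb{R}^n$. $\nabla f(\mathbb{R}^n)=\{\nabla f(x)\mid x\in\mathbb{R}^n\}$; its closure $\overline{\nabla f(\mathbb{R}^n)}$ is a closed convex set, so its minimum-norm point is uniquely determined. *)

(* Defs.v *)
From HB Require Import structures.
From mathcomp Require Import all_boot all_order all_algebra.
From mathcomp Require Import all_classical all_reals all_analysis.

Set Implicit Arguments.
Unset Strict Implicit.
Unset Printing Implicit Defensive.
Import Order.TTheory GRing.Theory Num.Theory.
Import numFieldNormedType.Exports.

Local Open Scope classical_set_scope.
Local Open Scope ring_scope.

(* Points of R^n are row vectors 'rV[R]_n.  The norm `|_| that MathComp-Analysis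
   puts on matrices is the sup norm, so the Euclidean structure is defined
   separately; the topology (limits, closure, differentiability) is the library's
   one, which in finite dimension is the Euclidean topology. *)
Definition inner (R : realType) (n : nat) (u v : 'rV[R]_n) : R :=
  \sum_(i < n) u ord0 i * v ord0 i.

Definition enorm (R : realType) (n : nat) (u : 'rV[R]_n) : R :=
  Num.sqrt (inner u u).

Definition gradient (R : realType) (n : nat) (f : 'rV[R]_n -> R)
    (x : 'rV[R]_n) : 'rV[R]_n :=
  \row_(i < n) 'D_(delta_mx ord0 i) f x.

(* Entry (i, j) is the i-th partial derivative of the j-th component of the
   gradient: the library's Jacobian acts on row vectors on the right, so the
   Hessian applied to u is u *m hessian f x. *)
Definition hessian (R : realType) (n : nat) (f : 'rV[R]_n -> R)
    (x : 'rV[R]_n) : 'M[R]_n :=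
  jacobian (gradient f) x.

Definition twice_continuously_differentiable (R : realType) (n : nat)
    (f : 'rV[R]_n -> R) : Prop :=
  [/\ forall x, differentiable f x,
      forall x, differentiable (gradient f) x
    & continuous (hessian f)].

Definition L_smooth (R : realType) (n : nat) (L : R) (f : 'rV[R]_n -> R) : Prop :=
  forall x u : 'rV[R]_n, inner (u *m hessian f x) u <= L * enorm u ^+ 2.

Definition is_min_norm_point (R : realType) (n : nat) (A : set 'rV[R]_n)
    (p : 'rV[R]_n) : Prop :=
  A p /\ forall q, A q -> enorm p <= enorm q.

(* x solves x' = - grad f(x), x(0) = x0 on [0, +oo[; at t = 0 the derivative is
   the right derivative, and the values of x at negative times are irrelevant. *)
Definition gradient_flow (R : realType) (n : nat) (f : 'rV[R]_n -> R)
    (x0 : 'rV[R]_n) (x : R -> 'rV[R]_n) : Prop :=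
  [/\ x 0 = x0,
      h^-1 *: (x h - x 0) @[h --> 0^'+] --> - gradient f (x 0)
    & forall t : R, 0 < t -> is_derive t 1 x (- gradient f (x t))].

Definition gradient_descent (R : realType) (n : nat) (f : 'rV[R]_n -> R)
    (L : R) (x0 : 'rV[R]_n) (i : nat) : 'rV[R]_n :=
  iter i (fun x => x - L^-1 *: gradient f x) x0.

(* Main.v *)
(* For a flow at time tau = t, or for gradient descent at step i with
   tau = i / L, the energy
     tau (f x - f y) + |x - y|^2 / 2 + tau^2 |grad f x|^2 / 2
   is nonincreasing for every fixed y.  Bounding f x - f y from below by
   <grad f y, x - y> and completing the square gives
     |x - y + tau grad f y|^2 + tau^2 (|grad f x|^2 - |grad f y|^2) <= |x0 - y|^2.
   Divide by tau^2.  Taking grad f y close to p* yields x / tau --> - p*, and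
   |grad f x| --> |p*|.  For fixed y, letting tau tend to infinity yields
   |grad f y - p*|^2 <= |grad f y|^2 - |p*|^2, and this at y = x gives
   grad f x --> p*. *)

Require Import Defs.
From HB Require Import structures.
From mathcomp Require Import all_boot all_order all_algebra.
From mathcomp Require Import all_classical all_reals all_analysis.
From mathcomp Require Import ring lra.

Set Implicit Arguments.
Unset Strict Implicit.
Unset Printing Implicit Defensive.
Import Order.TTheory GRing.Theory Num.Theory.
Import numFieldNormedType.Exports.

Local Open Scope classical_set_scope.
Local Open Scope ring_scope.

(** * Euclidean inner product: algebra, limits and derivatives *)

Section Inner.
Variables (R : realType) (n : nat).
Implicit Types u v w : 'rV[R]_n.

Lemma innerC u v : inner u v = inner v u.
Proof. by apply: eq_bigr => i _; rewrite mulrC. Qed.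

Lemma innerDl u v w : inner (u + v) w = inner u w + inner v w.
Proof.
by rewrite /inner -big_split; apply: eq_bigr => i _; rewrite !mxE mulrDl.
Qed.

Lemma innerZl a u v : inner (a *: u) v = a * inner u v.
Proof. by rewrite /inner mulr_sumr; apply: eq_bigr => i _; rewrite !mxE mulrA. Qed.

Lemma innerNl u v : inner (- u) v = - inner u v.
Proof. by rewrite -scaleN1r innerZl mulN1r. Qed.

Lemma innerDr u v w : inner u (v + w) = inner u v + inner u w.
Proof. by rewrite !(innerC u) innerDl. Qed.

Lemma innerZr a u v : inner u (a *: v) = a * inner u v.
Proof. by rewrite !(innerC u) innerZl. Qed.

Lemma innerNr u v : inner u (- v) = - inner u v.
Proof. by rewrite !(innerC u) innerNl. Qed.

Lemma inner0r u : inner u 0 = 0.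
Proof. by rewrite -(scale0r 0) innerZr mul0r. Qed.

Definition innerE := (innerDl, innerDr, innerNl, innerNr, innerZl, innerZr).

Lemma inner_sqrD u v : inner (u + v) (u + v) = inner u u + 2 * inner u v + inner v v.
Proof. by rewrite !innerE (innerC v u); ring. Qed.

Lemma inner_ge0 u : 0 <= inner u u.
Proof. by apply: sumr_ge0 => i _; rewrite -expr2 sqr_ge0. Qed.

Lemma enorm_sqr u : enorm u ^+ 2 = inner u u.
Proof. by rewrite sqr_sqrtr ?inner_ge0. Qed.

Lemma ler_enorm u v : (enorm u <= enorm v) = (inner u u <= inner v v).
Proof. by rewrite /enorm ler_sqrt ?inner_ge0. Qed.

(** The gap between the two sides is the sum of the squared norms of [u - v], [u - w] and
    [v - w]. *)
Lemma inner_sumD3_le u v w :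
  inner (u + v + w) (u + v + w) <= 3 * (inner u u + inner v v + inner w w).
Proof.
have := inner_ge0 (u - v); have := inner_ge0 (u - w); have := inner_ge0 (v - w).
rewrite !innerE (innerC v u) (innerC w u) (innerC w v); lra.
Qed.

(** Each squared coordinate is one nonnegative term of [inner u u]. This carries Euclidean estimates
    over to the sup norm, hence to the topology. *)
Lemma norm_le_inner u (e : R) : 0 <= e -> inner u u <= e ^+ 2 -> `|u| <= e.
Proof.
move=> e0 ue; rewrite /Num.Def.normr/= mx_normrE (bigmax_le _ e0)//= => -[i j] _.
rewrite ord1 /= -(ler_pXn2r (ltn0Sn 1)) ?nnegrE// real_normK ?num_real//.
apply: le_trans ue; rewrite /inner (bigD1 j)//= -expr2 lerDl.
by apply: sumr_ge0 => k _; rewrite -expr2 sqr_ge0.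
Qed.

Lemma cvg_inner (T : Type) (F : set_system T) {FF : Filter F}
    (u v : T -> 'rV[R]_n) (a b : 'rV[R]_n) :
  u @ F --> a -> v @ F --> b -> inner (u t) (v t) @[t --> F] --> inner a b.
Proof.
move=> ua vb; rewrite /inner.
apply: cvg_big => [|i _]; first exact: add_continuous.
by apply: cvgM; [exact: (cvg_comp _ _ ua (@coord_continuous _ _ _ ord0 i a))
               |exact: (cvg_comp _ _ vb (@coord_continuous _ _ _ ord0 i b))].
Qed.

Lemma cvg_of_inner (T : Type) (F : set_system T) {FF : Filter F}
    (u : T -> 'rV[R]_n) (a : 'rV[R]_n) :
  (forall e, 0 < e -> \forall t \near F, inner (u t - a) (u t - a) <= e) ->
  u @ F --> a.
Proof.
move=> h; apply/cvgrPdist_le => e e0.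
have := h _ (exprn_gt0 2 e0); apply: filterS => t ht.
by rewrite distrC; apply: norm_le_inner => //; exact: ltW.
Qed.

Lemma is_derive_inner (u v : R -> 'rV[R]_n) (du dv : 'rV[R]_n) (t : R) :
  is_derive t 1 u du -> is_derive t 1 v dv ->
  is_derive t 1 (fun t => inner (u t) (v t)) (inner du (v t) + inner (u t) dv).
Proof.
move=> [u1 u2] [v1 v2].
have -> : (fun t => inner (u t) (v t)) =
   \sum_(i < n) (fun s => u s ord0 i * v s ord0 i).
  by apply/funext => s; rewrite fct_sumE.
have dc (w : R -> 'rV[R]_n) dw i : derivable w t 1 -> 'D_1 w t = dw ->
    is_derive t 1 (fun s => w s ord0 i) (dw ord0 i).
  move=> w1 <-; rewrite derive_mx// mxE; apply: derivableP.
  exact: (derivable_mxP _ _ _).1.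
apply: is_derive_eq.
  apply: is_derive_sum => i.
  exact: is_deriveM (dc u du i u1 u2) (dc v dv i v1 v2).
rewrite /inner -big_split; apply: eq_bigr => i _ /=.
by rewrite addrC /GRing.scale /= (mulrC (du _ _)).
Qed.

End Inner.

(** * Differentiation along curves and monotonicity on a half-line *)

Lemma is_derive_comp_curve (R : realType) (V W : normedModType R)
    (F : V -> W) (x : R -> V) (v : V) (t : R) :
  differentiable F (x t) -> is_derive t 1 x v ->
  is_derive t 1 (F \o x) ('D_v F (x t)).
Proof.
move=> dF [/derivable1_diffP dx <-]; apply: DeriveDef.
  by apply/derivable1_diffP; exact: differentiable_comp.
rewrite !deriveE//; last exact: differentiable_comp.
by rewrite diff_comp.
Qed.

(** At 0 only right continuity is assumed, since a gradient flow is unconstrained at negative times.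
    Monotonicity holds between any [s > 0] and [t]; then [s] tends to 0 from the right. *)
Lemma nonincreasing_from0 (R : realType) (E dE : R -> R) :
  (forall t : R, 0 < t -> is_derive t 1 E (dE t)) ->
  (forall t : R, 0 < t -> dE t <= 0) ->
  E t @[t --> 0^'+] --> E 0 ->
  forall t : R, 0 < t -> E t <= E 0.
Proof.
move=> hE hdE E0 t t0; apply: (cvgr_to_ge E0).
near=> s.
have s0 : 0 < s by near: s; exact: nbhs_right_gt.
have st : s <= t by near: s; exact: nbhs_right_ltW.
(* The right end [t + 1] makes [t] an interior point of the open interval. *)
have pos (r : R) : r \in `]0, (t + 1)[%R -> 0 < r by rewrite in_itv /= => /andP[].
apply: (@ler0_derive1_le_oo _ E 0 (t + 1)) => //.
- by move=> r /pos r0; have [] := hE r r0.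
- by move=> r /pos r0; have [] := hE r r0; rewrite derive1E => _ ->; exact: hdE.
- move=> r; rewrite inE /= => /pos r0.
  by apply/differentiable_continuous/derivable1_diffP; have [] := hE r r0.
- by rewrite in_itv/= t0 ltrDl ltr01.
- by rewrite in_itv/= s0 (le_lt_trans st)// ltrDl ltr01.
Unshelve. all: by end_near. Qed.

Lemma is_derive_line (R : realType) (V : normedModType R) (x v : V) (t : R) :
  is_derive t 1 (fun t => x + t *: v) v.
Proof.
have h : h^-1 *: (((fun t => x + t *: v) \o shift t) (h *: 1) - (x + t *: v))
    @[h --> 0^'] --> v.
  apply: cvg_near_cst; near=> h.
  have h0 : h != 0 by near: h; exact: nbhs_dnbhs_neq.
  by rewrite /= [h%:A]mulr1 opprD addrACA subrr add0r -scalerBl addrK scalerA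
    mulVf// scale1r.
by apply: DeriveDef; [apply/cvg_ex; exists v|exact: cvg_lim h].
Unshelve. all: by end_near. Qed.

Lemma is_derive_continuous (R : realType) (V : normedModType R) (x : R -> V)
    (v : V) (t : R) :
  is_derive t 1 x v -> x s @[s --> t] --> x t.
Proof.
by move=> [dx _]; apply/differentiable_continuous/derivable1_diffP.
Qed.

(** * First-order inequalities for convex and [L]-smooth functions *)

Section Convex.
Variables (R : realType) (n : nat) (f : 'rV[R]_n -> R).
Hypothesis df : forall x, differentiable f x.
Local Notation G := (gradient f).

Lemma derive_gradient x v : 'D_v f x = inner (G x) v.
Proof.
rewrite deriveE// [in LHS](row_sum_delta v) linear_sum; apply: eq_bigr => i _.
by rewrite linearZ /= mxE deriveE// mulrC.
Qed.

Section FirstOrder.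
Hypothesis cf : convex_function setT f.

(** By convexity, the difference quotients of [f] at [x] towards [y] with step in ]0, 1] are at most
    [f y - f x]; their limit is the directional derivative. *)
Lemma convex_gradient_le x y : f x + inner (G x) (y - x) <= f y.
Proof.
have : h^-1 *: ((f \o shift x) (h *: (y - x)) - f x) @[h --> 0^'+]
    --> 'D_(y - x) f x.
  by apply: cvg_dnbhs_at_right; exact: (diff_derivable (df x)).
rewrite derive_gradient -lerBrDl => lim; apply: (cvgr_to_le lim).
near=> h.
have h0 : 0 < h by near: h; exact: nbhs_right_gt.
have h1 : h <= 1 by near: h; exact: nbhs_right_ltW.
rewrite /GRing.scale /= ler_pdivrMl//.
have : f (h *: y + (1 - h) *: x) <= h * f y + (1 - h) * f x.
  exact: (cf (Itv01 (ltW h0) h1) (mem_set I) (mem_set I)).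
rewrite (_ : _ *: y + _ = h *: (y - x) + x); last first.
  by rewrite scalerBr scalerBl scale1r addrAC addrA.
lra.
Unshelve. all: by end_near. Qed.

Lemma gradient_monotone x y : 0 <= inner (G y - G x) (y - x).
Proof.
have := convex_gradient_le x y; have := convex_gradient_le y x.
rewrite !innerE; lra.
Qed.

(** Positive semidefiniteness of the Hessian, as the limit of monotonicity of the gradient between
    [x] and [h *: v + x]. *)
Lemma derive_gradient_ge0 x v :
  differentiable G x -> 0 <= inner ('D_v G x) v.
Proof.
move=> dG.
have : inner (h^-1 *: ((G \o shift x) (h *: v) - G x)) v @[h --> 0^'+]
    --> inner ('D_v G x) v.
  apply: cvg_inner; last exact: cvg_cst.
  by apply: cvg_dnbhs_at_right; exact: (diff_derivable dG).
move=> lim; apply: (cvgr_to_ge lim); near=> h.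
have h0 : 0 < h by near: h; exact: nbhs_right_gt.
have := gradient_monotone x (h *: v + x).
by rewrite addrK innerZr pmulr_rge0// innerZl /= => ?; rewrite mulr_ge0// invr_ge0 ltW.
Unshelve. all: by end_near. Qed.

End FirstOrder.

(** Instead of a double integration, monotonicity is used twice along the line [x + t *: v]. The
    Hessian bound makes [dE] nonincreasing from [dE 0 = 0], so [dE <= 0]; as [dE] is the derivative
    of [E], it follows that [E 1 <= E 0]. *)
Lemma L_smooth_le (L : R) x v : (forall x, differentiable G x) ->
  L_smooth L f -> f (x + v) <= f x + inner (G x) v + L / 2 * inner v v.
Proof.
move=> dG Lf.
pose dE (t : R) := inner (G (x + t *: v)) v - inner (G x) v - t * (L * inner v v).
pose E (t : R) := f (x + t *: v) - t * inner (G x) v - t * t * (L / 2 * inner v v).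
have hdE (t : R) :
    is_derive t 1 dE (inner ('D_v G (x + t *: v)) v - L * inner v v).
  have l := is_derive_comp_curve (dG (x + t *: v)) (is_derive_line x v t).
  apply: (is_derive_eq (is_deriveB (is_deriveB (is_derive_inner l
    (is_derive_cst v t (1 : R))) (is_derive_cst (inner (G x) v) t (1 : R)))
    (is_deriveM (is_derive_id t (1 : R)) (is_derive_cst (L * inner v v) t (1 : R))))).
  by rewrite /GRing.scale /= inner0r; ring.
have hE (t : R) : is_derive t 1 E (dE t).
  have l := is_derive_comp_curve (df (x + t *: v)) (is_derive_line x v t).
  have did := is_derive_id t (1 : R).
  have dcst c := is_derive_cst (c : R) t (1 : R).
  apply: (is_derive_eq (is_deriveB (is_deriveB l (is_deriveM did (dcst (inner (G x) v))))
    (is_deriveM (is_deriveM did did) (dcst (L / 2 * inner v v))))).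
  by rewrite derive_gradient /dE /GRing.scale /=; lra.
have dE_le0 : forall t : R, 0 < t -> dE t <= 0.
  move=> t t0; have <- : dE 0 = 0 by rewrite /dE scale0r addr0; ring.
  apply: (nonincreasing_from0 (fun t _ => hdE t)) => // [s _|].
    by rewrite deriveEjacobian// subr_le0 -enorm_sqr; exact: Lf.
  exact/cvg_at_right_filter/is_derive_continuous.
have : E 1 <= E 0.
  apply: (nonincreasing_from0 (fun t _ => hE t)) => //.
  exact/cvg_at_right_filter/is_derive_continuous.
rewrite /E scale1r scale0r addr0; lra.
Qed.

End Convex.

(** * Limits deduced from the trajectory estimate alone, for a general map [G] and time scale
    [tau] *)

Definition trajectory_estimate (R : realType) (n : nat)
    (G : 'rV[R]_n -> 'rV[R]_n) (x0 : 'rV[R]_n) (tau : R) (x : 'rV[R]_n) : Prop :=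
  forall y, inner (x - y + tau *: G y) (x - y + tau *: G y) +
    tau ^+ 2 * (inner (G x) (G x) - inner (G y) (G y)) <= inner (x0 - y) (x0 - y).

Section Asymptotics.
Variables (R : realType) (n : nat) (G : 'rV[R]_n -> 'rV[R]_n).
Context {T : topologicalType} {F : set_system T} {FF : ProperFilter F}.
Variables (tau : T -> R) (X : T -> 'rV[R]_n) (x0 p : 'rV[R]_n).
Hypothesis tau_pinfty : tau @ F --> +oo.
Hypothesis estimate :
  \forall t \near F, trajectory_estimate G x0 (tau t) (X t).
Hypothesis pG : closure (range G) p.
Hypothesis p_min : forall y, inner p p <= inner (G y) (G y).

Let tauV_cvg0 : (tau t)^-1 @[t --> F] --> (0 : R).
Proof.
apply/gtr0_cvgV0 => //; move/cvgryPgt : tau_pinfty; exact.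
Qed.

Let estimate_scaled y : \forall t \near F,
  inner ((tau t)^-1 *: X t - (tau t)^-1 *: y + G y)
        ((tau t)^-1 *: X t - (tau t)^-1 *: y + G y) +
  inner (G (X t)) (G (X t)) - inner (G y) (G y)
  <= (tau t)^-1 ^+ 2 * inner (x0 - y) (x0 - y).
Proof.
near=> t.
have t0 : 0 < tau t by near: t; move/cvgryPgt : tau_pinfty; exact.
have : trajectory_estimate G x0 (tau t) (X t) by near: t; exact: estimate.
move=> /(_ y).
rewrite -(ler_pM2l (exprn_gt0 2 (_ : 0 < (tau t)^-1))) ?invr_gt0//.
apply: le_trans.
have -> : (tau t)^-1 *: X t - (tau t)^-1 *: y + G y =
    (tau t)^-1 *: (X t - y + tau t *: G y).
  by rewrite scalerDr scalerA mulVf ?gt_eqF// scale1r scalerBr.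
have ttV : (tau t)^-1 ^+ 2 * tau t ^+ 2 = 1.
  by rewrite -exprMn mulVf ?gt_eqF// expr1n.
by rewrite innerZl innerZr [leRHS]mulrDr [_ ^+ 2 * (_ * _)]mulrA ttV mul1r mulrA
  -expr2 addrA.
Unshelve. all: by end_near. Qed.

Let quad_cvg0 (c : R) : (tau t)^-1 ^+ 2 * c @[t --> F] --> (0 : R).
Proof.
rewrite -[X in _ --> X](_ : 0 * 0 * c = 0); last by rewrite !mul0r.
apply: cvgMr_tmp; exact: cvgM tauV_cvg0 tauV_cvg0.
Qed.

Let quad_small (c e : R) : 0 < e -> \forall t \near F, (tau t)^-1 ^+ 2 * c <= e.
Proof. by move=> e0; apply: (cvgr_le 0) e e0; exact: quad_cvg0. Qed.

(** The point [p] lies only in the closure and may not be a value of [G], so it is replaced by a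
    nearby value. *)
Let near_min (e : R) : 0 < e -> exists y,
  inner (G y) (G y) <= inner p p + e /\ inner (G y - p) (G y - p) <= e.
Proof.
move=> e0.
have idp : (fun q : 'rV[R]_n => q) @ p --> p by [].
have nb1 : \forall q \near p, inner q q <= inner p p + e.
  by apply: cvgr_le (cvg_inner idp idp) _ _; rewrite ltrDl.
have dp : (fun q : 'rV[R]_n => q - p) @ p --> p - p.
  by apply: (cvgD idp); exact: cvg_cst.
have nb2 : \forall q \near p, inner (q - p) (q - p) <= e.
  by apply: cvgr_le (cvg_inner dp dp) _ _; rewrite subrr inner0r.
by have [_ [[y _ <-] [? ?]]] := pG (filterI nb1 nb2); exists y.
Qed.

Lemma cvg_scaled_trajectory : (tau t)^-1 *: X t @[t --> F] --> - p.
Proof.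
apply: cvg_of_inner => e e0.
(* In the three-term bound below, the squares are at most [2 * (e / 12)], [e / 12] and [e / 12]; the
   factor 3 brings the total to [e]. *)
have e12 : 0 < e / 12 by rewrite divr_gt0.
have [y [y1 y2]] := near_min e12.
near=> t.
have h1 : (tau t)^-1 ^+ 2 * inner (x0 - y) (x0 - y) <= e / 12.
  by near: t; exact: quad_small.
have h2 : (tau t)^-1 ^+ 2 * inner y y <= e / 12 by near: t; exact: quad_small.
have h3 : inner ((tau t)^-1 *: X t - (tau t)^-1 *: y + G y)
        ((tau t)^-1 *: X t - (tau t)^-1 *: y + G y) +
  inner (G (X t)) (G (X t)) - inner (G y) (G y)
  <= (tau t)^-1 ^+ 2 * inner (x0 - y) (x0 - y).
  by near: t; exact: estimate_scaled.
have h4 := p_min (X t).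
rewrite opprK.
(* The three vectors add up to [(tau t)^-1 *: X t + p]. *)
have := inner_sumD3_le ((tau t)^-1 *: X t - (tau t)^-1 *: y + G y)
  ((tau t)^-1 *: y) (p - G y).
rewrite [_ + G y + _]addrAC subrK [p - _]addrC addrA addrK.
rewrite [- G y + p]addrC.
have -> : inner (p - G y) (p - G y) = inner (G y - p) (G y - p).
  by rewrite -opprB innerNl innerNr opprK.
have -> : inner ((tau t)^-1 *: y) ((tau t)^-1 *: y) = (tau t)^-1 ^+ 2 * inner y y.
  by rewrite innerZl innerZr mulrA.
lra.
Unshelve. all: by end_near. Qed.

(** Equivalent to [inner p (G y - p) >= 0], the variational inequality of a projection of 0 onto a
    convex set. Here it comes from the trajectory rather than from convexity of the closure: [y]
    stays fixed in the scaled estimate, [p_min] bounds the gradient at [X t] from below, and [t]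
    goes to the limit. *)
Lemma min_norm_variational y :
  inner (G y - p) (G y - p) <= inner (G y) (G y) - inner p p.
Proof.
have Zc : (tau t)^-1 *: X t - (tau t)^-1 *: y + G y @[t --> F] -->
    - p - (0 : R) *: y + G y.
  apply: cvgD; last exact: cvg_cst.
  apply: cvgB; first exact: cvg_scaled_trajectory.
  exact: cvgZr_tmp.
have -> : G y - p = - p - (0 : R) *: y + G y by rewrite scale0r subr0 addrC.
rewrite -[leRHS]add0r; apply: (ler_cvg_to (cvg_inner Zc Zc)
  (cvgD (quad_cvg0 (inner (x0 - y) (x0 - y)))
    (cvg_cst (inner (G y) (G y) - inner p p)))).
near=> t.
have h3 : inner ((tau t)^-1 *: X t - (tau t)^-1 *: y + G y)
        ((tau t)^-1 *: X t - (tau t)^-1 *: y + G y) +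
  inner (G (X t)) (G (X t)) - inner (G y) (G y)
  <= (tau t)^-1 ^+ 2 * inner (x0 - y) (x0 - y).
  by near: t; exact: estimate_scaled.
by rewrite fctE; have := p_min (X t); lra.
Unshelve. all: by end_near. Qed.

Lemma cvg_gradient_trajectory : G (X t) @[t --> F] --> p.
Proof.
apply: cvg_of_inner => e e0.
(* One half pays for the excess of [inner (G y) (G y)] over [inner p p], the other for the vanishing
   right side of the estimate. *)
have e2 : 0 < e / 2 by rewrite divr_gt0.
have [y [y1 y2]] := near_min e2.
near=> t.
have h1 : (tau t)^-1 ^+ 2 * inner (x0 - y) (x0 - y) <= e / 2.
  by near: t; exact: quad_small.
have h3 : inner ((tau t)^-1 *: X t - (tau t)^-1 *: y + G y)
        ((tau t)^-1 *: X t - (tau t)^-1 *: y + G y) +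
  inner (G (X t)) (G (X t)) - inner (G y) (G y)
  <= (tau t)^-1 ^+ 2 * inner (x0 - y) (x0 - y).
  by near: t; exact: estimate_scaled.
have := inner_ge0 ((tau t)^-1 *: X t - (tau t)^-1 *: y + G y).
have := min_norm_variational (X t); lra.
Unshelve. all: by end_near. Qed.

End Asymptotics.

(** * Energy inequalities for gradient descent and gradient flow *)

Section Trajectories.
Variables (R : realType) (n : nat) (f : 'rV[R]_n -> R).
Hypothesis df : forall x, differentiable f x.
Hypothesis dG : forall x, differentiable (gradient f) x.
Hypothesis cf : convex_function setT f.
Local Notation G := (gradient f).

(** The value of [f] at [y - L^-1 *: d] is bounded below by the tangent at [x] and above by the
    quadratic bound at [y]. This point is a gradient step from [y] for [f] minus the linear form
    [inner (G x)], whose gradient at [y] is [d]. *)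
Lemma cocoercive_gradient (L : R) x y : 0 < L -> L_smooth L f ->
  f x + inner (G x) (y - x) + (2 * L)^-1 * inner (G y - G x) (G y - G x) <= f y.
Proof.
move=> L0 Lf.
set d := G y - G x.
have := convex_gradient_le df cf x (y + (- L^-1) *: d).
have := L_smooth_le df y ((- L^-1) *: d) dG Lf.
have -> : y + - L^-1 *: d - x = (y - x) + - L^-1 *: d by rewrite addrAC.
rewrite [inner (G x) (_ + _)]innerDr !innerZr !innerZl.
have -> : inner (G y) d = inner (G x) d + inner d d.
  by rewrite -innerDl addrC subrK.
have -> : L / 2 * (- L^-1 * (- L^-1 * inner d d)) = (2 * L)^-1 * inner d d.
  by field; rewrite gt_eqF.
have -> : L^-1 = 2 * (2 * L)^-1 by field; rewrite gt_eqF.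
lra.
Qed.

Lemma energy_trajectory_estimate (x0 x : 'rV[R]_n) (tau : R) : 0 <= tau ->
  (forall y, tau * (f x - f y) + 2^-1 * inner (x - y) (x - y) +
    tau ^+ 2 / 2 * inner (G x) (G x) <= 2^-1 * inner (x0 - y) (x0 - y)) ->
  trajectory_estimate G x0 tau x.
Proof.
move=> tau0 energy y; have h := energy y.
have := ler_wpM2l tau0 (convex_gradient_le df cf y x).
rewrite inner_sqrD !innerZl !innerZr (innerC (x - y) (G y)); lra.
Qed.

Lemma gradient_descent_energy (L : R) x0 y i : 0 < L -> L_smooth L f ->
  let x := gradient_descent f L x0 i in
  i%:R / L * (f x - f y) + 2^-1 * inner (x - y) (x - y) +
    (i%:R / L) ^+ 2 / 2 * inner (G x) (G x) <= 2^-1 * inner (x0 - y) (x0 - y).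
Proof.
move=> L0 Lf /=; elim: i => [|i]; first by rewrite /= !mul0r expr0n /=; lra.
apply: le_trans; rewrite [gradient_descent _ _ _ i.+1]/=.
rewrite -/(gradient_descent f L x0 i); set x := gradient_descent f L x0 i.
set x' := x - L^-1 *: G x.
(* Since [x - x' = L^-1 *: G x], the cross terms cancel and this becomes the decrease
   [f x' + (P + Q) / (2 * L) <= f x], with [P] and [Q] as set below. *)
have h1 := cocoercive_gradient x' x L0 Lf.
have h2 := convex_gradient_le df cf x y.
have e1 : inner (G x') (x - x') = L^-1 * inner (G x') (G x).
  by rewrite /x' opprB addrCA subrr addr0 innerZr.
have e2 : inner (x' - y) (x' - y) =
    inner (x - y) (x - y) + 2 * L^-1 * inner (G x) (y - x) + L^-1 ^+ 2 * inner (G x) (G x).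
  have -> : x' - y = (x - y) - L^-1 *: G x by rewrite /x' addrAC.
  rewrite -(opprB x y) inner_sqrD !innerNl !innerNr !innerZl !innerZr.
  by rewrite (innerC (x - y)); ring.
have e3 : inner (G x - G x') (G x - G x') =
    inner (G x) (G x) - 2 * inner (G x') (G x) + inner (G x') (G x').
  by rewrite inner_sqrD !innerNl !innerNr (innerC (G x) (G x')); ring.
rewrite e2 -natr1; rewrite e1 e3 in h1.
have i0 : 0 <= i%:R :> R by [].
(* Added to [h1], the same inequality with the points exchanged eliminates the values of [f] and
   gives [Q <= S]. *)
have h3 := cocoercive_gradient x x' L0 Lf.
have e4 : inner (G x) (x' - x) = - (L^-1 * inner (G x) (G x)).
  by rewrite /x' addrAC subrr add0r innerNr innerZr.
have e5 : inner (G x' - G x) (G x' - G x) =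
    inner (G x) (G x) - 2 * inner (G x') (G x) + inner (G x') (G x').
  by rewrite -opprB innerNl innerNr opprK.
rewrite e4 e5 in h3.
have h4 := inner_ge0 (G x - G x'); rewrite e3 in h4.
move: h1 h2 h3 h4.
set P := inner (G x) (G x); set Q := inner (G x') (G x'); set S := inner (G x') (G x).
have -> : (2 * L)^-1 = L^-1 / 2 by field; rewrite gt_eqF.
have : 0 < L^-1 by rewrite invr_gt0.
clear e1 e2 e3 e4 e5; clearbody P Q S.
move: (L^-1) (i%:R) i0 => l c c0 l0 h1 h2 h3 h4.
(* With [h4] this gives [Q <= P]: the gradient norm does not increase. *)
have QS : Q <= S by rewrite -(ler_pM2l l0); lra.
(* The change of energy over one step is the sum of this term, the next one and half of the third,
   all nonpositive. *)
have : (c + 1) * l * (f x' - f x + l / 2 * (P + Q)) <= 0.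
  by rewrite mulr_ge0_le0// ?mulr_ge0// ?addr_ge0// ?(ltW l0)//; lra.
have : l * (f x + inner (G x) (y - x) - f y) <= 0.
  by rewrite mulr_ge0_le0// ?(ltW l0)//; lra.
have : (c * (c + 1) * (l * l)) * (Q - P) <= 0.
  by rewrite mulr_ge0_le0// ?mulr_ge0// ?addr_ge0// ?(ltW l0)//; lra.
lra.
Qed.

Lemma gradient_flow_energy x0 x y (t : R) : 0 < t -> gradient_flow f x0 x ->
  t * (f (x t) - f y) + 2^-1 * inner (x t - y) (x t - y) +
    t ^+ 2 / 2 * inner (G (x t)) (G (x t)) <= 2^-1 * inner (x0 - y) (x0 - y).
Proof.
move=> t0 [<- x'0 dx].
pose g t := G (x t).
pose H t := 'D_(- g t) G (x t).
pose E (t : R) := t * (f (x t) - f y) + inner (x t - y) (x t - y) * 2^-1 +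
  t * t * (inner (g t) (g t) * 2^-1).
(* In the derivative of [E], the term [- t * inner (g t) (g t)] from the decrease of [f] cancels
   against the derivative of the factor [t * t]. What remains is nonpositive by the tangent
   inequality and, as [H] is the derivative of [g] in the direction [- g], by semidefiniteness of
   the Hessian. *)
pose dE (t : R) := f (x t) - f y - inner (g t) (x t - y) + t * t * inner (H t) (g t).
have hE : forall t : R, 0 < t -> is_derive t 1 E (dE t).
  move=> {t0}t t0; have xt := dx t t0.
  have dfx := is_derive_comp_curve (df (x t)) xt.
  have dGx := is_derive_comp_curve (dG (x t)) xt.
  have did := is_derive_id t (1 : R).
  have dcst c := is_derive_cst (c : R) t (1 : R).
  have dxy : is_derive t 1 (fun t => x t - y) (- G (x t)).
    by apply: (is_derive_eq (is_deriveB xt (is_derive_cst y t (1 : R)))); rewrite subr0.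
  apply: (is_derive_eq (is_deriveD (is_deriveD
    (is_deriveM did (is_deriveB dfx (dcst (f y))))
    (is_deriveM (is_derive_inner dxy dxy) (dcst 2^-1)))
    (is_deriveM (is_deriveM did did)
      (is_deriveM (is_derive_inner dGx dGx) (dcst 2^-1))))).
  rewrite derive_gradient// /dE /H /g /GRing.scale /= !fctE /= !innerNr !innerNl.
  rewrite (innerC (G (x t)) ('D_ _ _ _)) (innerC (x t - y)).
  by lra.
have E0 : E t @[t --> 0^'+] --> E 0.
  have idc : (fun t : R => t) @ 0^'+ --> (0 : R) by exact: cvg_at_right_filter.
  (* Right continuity is recovered from the right derivative: [x h] is [x 0] plus [h] times a
     convergent quotient. *)
  have xc : x t @[t --> 0^'+] --> x 0.
    rewrite -[x 0 in X in _ --> X]addr0 -(scale0r (- G (x 0))).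
    apply: cvg_trans (cvgD (cvg_cst (x 0)) (cvgZ idc x'0)).
    apply: near_eq_cvg; near=> h.
    have h0 : 0 < h by near: h; exact: nbhs_right_gt.
    by rewrite !fctE /= scalerA mulfV ?gt_eqF// scale1r addrC subrK.
  have gc : g t @[t --> 0^'+] --> g 0.
    exact: (cvg_comp _ _ xc (differentiable_continuous (dG (x 0)))).
  have fc : f (x t) @[t --> 0^'+] --> f (x 0).
    exact: (cvg_comp _ _ xc (differentiable_continuous (df (x 0)))).
  have xyc : x t - y @[t --> 0^'+] --> x 0 - y.
    by apply: (cvgD xc); exact: cvg_cst.
  apply: cvgD.
    apply: cvgD.
      by apply: cvgM => //; apply: cvgD => //; exact: cvg_cst.
    by apply: cvgMr_tmp; exact: cvg_inner.
  by apply: (cvgM (cvgM idc idc)); apply: cvgMr_tmp; exact: (cvg_inner gc gc).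
have dE_le0 : forall t : R, 0 < t -> dE t <= 0.
  move=> {t0}t t0.
  have h1 := convex_gradient_le df cf (x t) y.
  have h2 := derive_gradient_ge0 df cf (- g t) (dG (x t)).
  move: h2; rewrite -/(H t) innerNr oppr_ge0 => h2.
  rewrite -(opprB (x t)) innerNr in h1.
  have := mulr_ge0_le0 (mulr_ge0 (ltW t0) (ltW t0)) h2.
  rewrite /dE; move: h1; rewrite -/(g t); lra.
have := nonincreasing_from0 hE dE_le0 E0 t0.
rewrite /E !mul0r add0r addr0 /g; lra.
Unshelve. all: by end_near. Qed.

End Trajectories.

Theorem theorem3p15 (R : realType) (n : nat) (f : 'rV[R]_n -> R)
    (x0 pstar : 'rV[R]_n)
    (f_C2 : twice_continuously_differentiable f)
    (f_convex : convex_function setT f)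
    (pstar_min : is_min_norm_point (closure (range (gradient f))) pstar)
    (kappa_gt0 : 0 < inf (range (fun x : 'rV[R]_n => enorm (gradient f x)))) :
  (forall x : R -> 'rV[R]_n, gradient_flow f x0 x ->
     (gradient f (x t) @[t --> +oo] --> pstar) /\
     (t^-1 *: x t @[t --> +oo] --> - pstar)) /\
  (forall L : R, 0 < L -> L_smooth L f ->
     (gradient f (gradient_descent f L x0 i) @[i --> \oo] --> pstar) /\
     ((i%:R)^-1 *: gradient_descent f L x0 i @[i --> \oo] --> - (L^-1 *: pstar))).
Proof.
have [df dG _] := f_C2.
have [pG p_min'] := pstar_min.
have p_min y : inner pstar pstar <= inner (gradient f y) (gradient f y).
  by rewrite -ler_enorm; apply: p_min'; apply: subset_closure; exists y.
split=> [x fx|L L0 Lf].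
  have est : \forall t \near +oo, trajectory_estimate (gradient f) x0 t (x t).
    near=> t; have t0 : 0 < t by [].
    apply: energy_trajectory_estimate => // y.
    exact: gradient_flow_energy.
  split.
    exact: (cvg_gradient_trajectory (tau := id) (@cvg_id _ _) est pG p_min).
  exact: (cvg_scaled_trajectory (tau := id) (@cvg_id _ _) est pG p_min).
have tau_oo : (i%:R / L : R) @[i --> \oo] --> +oo.
  have /cvgryPge ioo := @cvgr_idn R.
  by apply/cvgryPge => A; apply: filterS (ioo (A * L)) => i; rewrite ler_pdivlMr.
have est : \forall i \near \oo, trajectory_estimate (gradient f) x0 (i%:R / L)
    (gradient_descent f L x0 i).
  apply: nearW => i; apply: energy_trajectory_estimate => // [|y].
    by rewrite divr_ge0// ltW.
  exact: gradient_descent_energy.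
split; first exact: (cvg_gradient_trajectory tau_oo est pG p_min).
have Xc := cvg_scaled_trajectory tau_oo est pG p_min.
(* Passing from the scale [i / L] to [i] costs a factor [L^-1]. The identity also holds at [i = 0],
   where both inverses are 0. *)
rewrite -scalerN (_ : (fun i => _) = fun i : nat =>
    L^-1 *: ((i%:R / L)^-1 *: gradient_descent f L x0 i)).
  exact: (cvgZl_tmp (k := L^-1) (Xc _)).
by apply/funext => i; rewrite scalerA invf_div mulrA mulVf ?gt_eqF// mul1r.
Unshelve. all: by end_near. Qed.
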